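(* Let $n\ge 2$. The closure of any distinguished variety in $\mathbb G_n$ is polynomially convex.
   Context: $\mathbb D$ is the open unit disc, $\mathbb T$ the unit circle. $\pi_n(z)=\big(\sum_i z_i,\sum_{i<j}z_iz_j,\dots,\prod_iz_i\big)$ is the symmetrization map on $\mathbb C^n$; $\mathbb G_n=\pi_n(\mathbb D^n)$ is the symmetrized polydisc, $\Gamma_n=\overline{\mathbb G_n}=\pi_n(\overline{\mathbb D}^n)$, $b\Gamma_n=\pi_n(\mathbb T^n)$ is the distinguished boundary and $\partial\Gamma_n=\Gamma_n\setminus\mathbb G_n$. A distinguished set in $\mathbb G_n$ is a set $\Lambda=\mathbb G_n\cap V$, where $V\subset\mathbb C^n$ is an algebraic set (common zero set of polynomials) of complex dimension $>0$ such that, with $\overline\Lambda:=V\cap\Gamma_n$ (called the closure of $\Lambda$), $\overline\Lambda\cap\partial\Gamma_n=\overline\Lambda\cap b\Gamma_n$. A distinguished variety is an irreducible distinguished set. A compact set $X\subset\mathbb C^n$ is polynomially convex if for every $x\in\mathbb C^n\setminus X$ there is a polynomial $f$ with $|f(x)|>\sup_{y\in X}|f(y)|$. *)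

(* Defs.v *)
From HB Require Import structures.
From mathcomp Require Import all_boot all_order all_algebra.
From mathcomp Require Import all_classical all_reals all_analysis.
From mathcomp Require Import complex.
(* mpoly is not imported: its notations clash with those of analysis. *)
From mathcomp Require mpoly.

Set Implicit Arguments.
Unset Strict Implicit.
Unset Printing Implicit Defensive.

Import Order.TTheory GRing.Theory Num.Theory numFieldNormedType.Exports.

Local Open Scope classical_set_scope.
Local Open Scope ring_scope.

(* The usual topology on the complex numbers, defined by the modulus. *)
HB.instance Definition _ (R : realType) :=
  NormedModule.copy R[i] (R[i]^o).

Section SymmetrizedPolydisc.
Variables (R : realType) (n : nat).
Local Notation C := (R[i]).
Local Notation Cn := ('rV[R[i]]_n).
Local Notation polynomial := (mpoly.mpoly n C).

Definition peval (p : polynomial) (z : Cn) : C := mpoly.meval (z ord0) p.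

(* `|z| lives in C; the modulus is needed in R to take suprema. *)
Definition modulus (z : C) : R := Normc.normc z.

(* Coordinate k of pi_n is the elementary symmetric polynomial of degree k + 1,
   since coordinates are numbered from 0. *)
Definition symmetrization (z : Cn) : Cn :=
  \row_(k < n) peval (mpoly.mesym n C k.+1) z.

Definition polydisc : set Cn := [set z | forall i, modulus (z ord0 i) < 1].

Definition torus : set Cn := [set z | forall i, modulus (z ord0 i) = 1].

Definition G : set Cn := symmetrization @` polydisc.

Definition Gamma : set Cn := closure G.

Definition bGamma : set Cn := symmetrization @` torus.

(* The topological boundary, as opposed to the distinguished boundary. *)
Definition dGamma : set Cn := Gamma `\` G.

Definition algebraic_set (V : set Cn) : Prop :=
  exists S : set polynomial, V = [set z | forall p, S p -> peval p z = 0].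

(* Irreducibility for the topology induced on A by the Zariski topology; A need
   not be closed. *)
Definition irreducible (A : set Cn) : Prop :=
  A !=set0 /\
  forall V W, algebraic_set V -> algebraic_set W ->
    A `<=` V `|` W -> A `<=` V \/ A `<=` W.

Definition irreducible_chain (V : set Cn) (d : nat) (Z : nat -> set Cn) : Prop :=
  (forall i, (i <= d)%N ->
     [/\ algebraic_set (Z i), irreducible (Z i) & Z i `<=` V]) /\
  (forall i, (i < d)%N -> Z i `<` Z i.+1).

(* The Krull dimension, -oo for the empty set. *)
Definition complex_dim (V : set Cn) : \bar R :=
  ereal_sup [set (d%:R)%:E | d in [set d | exists Z, irreducible_chain V d Z]].

(* The closure of G `&` V in the sense of distinguished sets; it depends on V,
   and is not the topological closure. *)
Definition dclosure (V : set Cn) : set Cn := V `&` Gamma.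

Definition distinguished_set (V Lambda : set Cn) : Prop :=
  [/\ algebraic_set V,
      (0 < complex_dim V)%E,
      Lambda = G `&` V
    & dclosure V `&` dGamma = dclosure V `&` bGamma].

Definition distinguished_variety (V Lambda : set Cn) : Prop :=
  distinguished_set V Lambda /\ irreducible Lambda.

Definition polynomially_convex (X : set Cn) : Prop :=
  compact X /\
  forall x, ~ X x ->
    exists f : polynomial,
      sup [set modulus (peval f y) | y in X] < modulus (peval f x).

End SymmetrizedPolydisc.

(* Main.v *)
Require Import Defs.
From mathcomp Require Import all_boot all_order all_algebra.
From mathcomp Require Import all_classical all_reals all_analysis.
From mathcomp Require Import fingroup perm complex.
From mathcomp Require Import (canonicals, coercions) mpoly.

Set Implicit Arguments.
Unset Strict Implicit.
Unset Printing Implicit Defensive.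

Import Order.TTheory GRing.Theory Num.Theory numFieldNormedType.Exports.

Local Open Scope classical_set_scope.
Local Open Scope ring_scope.

(** The closure of a distinguished variety is V `&` Gamma with V algebraic, so
    it is enough that Gamma is compact and polynomially convex: a point outside
    V is separated from V by an equation of V that it does not satisfy, since
    that polynomial has supremum 0 on V `&` Gamma.

    Gamma is the image of the closed polydisc under the symmetrization map pi:
    the image is compact, hence closed, and it contains G; conversely pi z is
    the limit of pi (t z) as t tends to 1 from below ([GammaE]).

    A point outside Gamma is pi z with some |z_i| > 1, because pi is surjective
    on C^n (split the monic polynomial whose coefficients are the coordinates of
    the point, up to sign). The separating polynomials come from the powers
    z^m = (z_1^m, .., z_n^m): for all k and m, e_k (z^m) is symmetric in z,
    hence equal to f (pi z) for a polynomial f. On the closed polydisc it is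
    bounded by 2^n, the number of subsets of the n variables, whatever k and m
    are. If this bound also held at z for all k and m, then every polynomial
    prod_j (X - z_j^m) would have coefficients of modulus at most 2^n, so its
    root z_i^m would satisfy |z_i|^m <= n 2^n for every m (Cauchy's bound
    [monic_root_norm_le]), which is absurd since |z_i| > 1. *)

(** * Roots and powers *)

(** Cauchy's bound: if 1 <= |w|, each of the n lower terms of p has modulus at
    most B |w|^(n-1), while their sum is - w^n. *)
Lemma monic_root_norm_le (K : numFieldType) (n : nat) (p : {poly K}) (w B : K) :
  p \is monic -> size p = n.+1 -> root p w ->
  (forall i, (i < n)%N -> `|p`_i| <= B) -> 1 <= `|w| -> `|w| <= n%:R * B.
Proof.
move=> pm szp /rootP pw0 pB w1.
have w0 : 0 < `|w| by rewrite (lt_le_trans ltr01).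
move: pw0; rewrite horner_coef szp big_ord_recr /=.
have -> : p`_n = 1 by move/monicP: pm; rewrite lead_coefE szp.
rewrite mul1r => /eqP; rewrite addrC addr_eq0 => /eqP /(congr1 Num.norm).
rewrite normrN normrX => wn.
case: n => [|n] in szp pB wn *.
  by move: wn; rewrite big_ord0 normr0 expr0 => /eqP; rewrite oner_eq0.
rewrite -(ler_pM2r (exprn_gt0 n w0)) -exprS wn.
apply: (le_trans (ler_norm_sum _ _ _)).
rewrite -mulrA -[n.+1 in X in _ <= X]card_ord mulr_natl -sumr_const.
apply: ler_sum => i _; rewrite normrM normrX.
by rewrite ler_pM ?pB //  ler_weXn2l // -ltnS.
Qed.

Lemma exists_expr_gt (R : archiRealFieldType) (r c : R) :
  1 < r -> exists m : nat, c < r ^+ m.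
Proof.
move=> r1; have r10 : 0 < r - 1 by rewrite subr_gt0.
have bernoulli m : m%:R * (r - 1) <= r ^+ m - 1.
  rewrite subrX1 mulrC ler_wpM2l ?(ltW r10) //.
  rewrite -[m in leLHS]card_ord -sumr_const; apply: ler_sum => i _.
  exact/exprn_ege1/ltW.
set m := (Num.truncn (c / (r - 1))).+1; exists m.
have c_lt : c < m%:R * (r - 1) by rewrite -ltr_pdivrMr // truncnS_gt.
by rewrite (lt_le_trans c_lt) // (le_trans (bernoulli m)) // lerBlDr lerDl.
Qed.

(** * Symmetric polynomials in the roots *)

Section SymmetrizedPolydisc.
Variables (R : realType) (n : nat).
Local Notation C := (R[i]).
Local Notation Cn := ('rV[R[i]]_n).
Local Notation polynomial := (mpoly.mpoly n C).
Implicit Types (z : Cn) (p : polynomial) (k m : nat).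

Lemma normC_modulus (c : C) : `|c| = (modulus c)%:C%C.
Proof. by []. Qed.

Lemma modulus_real (r : R) : modulus r%:C%C = `|r|.
Proof. by rewrite /modulus /= expr0n addr0 sqrtr_sqr. Qed.

(** The fundamental theorem on symmetric polynomials, read as functions. *)
Lemma peval_symmetrization p : p \is mpoly.symmetric ->
  exists t : polynomial, forall z, peval t (symmetrization z) = peval p z.
Proof.
move=> /mpoly.sym_fundamental [t [<- _]]; exists t => y.
rewrite /peval mpoly.comp_mpoly_meval; apply: mpoly.meval_eq => i.
by rewrite mxE tnth_mktuple.
Qed.

(** The polynomial z |-> e_k (z_1^m, .., z_n^m). *)
Definition mesym_powers k m : polynomial :=
  mpoly.comp_mpoly [tuple mpoly.mpolyX C (mpoly.mnm1 i) ^+ m | i < n]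
    (mpoly.mesym n C k).

Definition powers m z : Cn := \row_i z ord0 i ^+ m.

Lemma mesym_powersE k m z :
  peval (mesym_powers k m) z = peval (mpoly.mesym n C k) (powers m z).
Proof.
rewrite /peval mpoly.comp_mpoly_meval; apply: mpoly.meval_eq => i.
by rewrite mxE tnth_mktuple rmorphXn /= mpoly.mevalXU.
Qed.

Lemma mesym_powers_sym k m : mesym_powers k m \is mpoly.symmetric.
Proof.
apply: mpoly.msym_comp_poly; first exact: mpoly.mesym_sym.
move=> s; apply/tuple_permP; exists (s^-1)%g.
congr val; apply: eq_from_tnth => i.
rewrite !tnth_mktuple -tnth_nth !tnth_mktuple rmorphXn /=.
by rewrite /mpoly.msym mpoly.mmapX mpoly.mmap1U permKV.
Qed.

(** e_k is a sum over the k-subsets of the variables, of which there are at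
    most 2^n, each term being a product of numbers of modulus at most 1. *)
Lemma mesym_peval_le k z : (forall i, `|z ord0 i| <= 1) ->
  `|peval (mpoly.mesym n C k) z| <= (2 ^ n)%:R.
Proof.
move=> z1; rewrite /peval /mpoly.mesym raddf_sum /=.
apply: (le_trans (ler_norm_sum _ _ _)).
rewrite -[n in X in _ <= X]card_ord -cardsT -card_powerset -sumr_const.
rewrite powersetT big_mkcond [leRHS]big_mkcond; apply: ler_sum => h _.
rewrite inE; case: ifP => // _.
rewrite rmorph_prod normr_prod; apply: prodr_ile1 => i _.
by rewrite /= mpoly.mevalXU normr_ge0 z1.
Qed.

Definition roots_poly z : {poly C} :=
  \prod_(c <- [tuple z ord0 i | i < n]) ('X - c%:P).

Lemma roots_poly_coef_norm z k : (k <= n)%N ->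
  `|(roots_poly z)`_(n - k)| = `|peval (mpoly.mesym n C k) z|.
Proof.
rewrite -ltnS => kn; rewrite (mpoly.mroots_coeff _ (Ordinal kn)) /=.
rewrite normrM normrX normrN1 expr1n mul1r.
by congr `|_|; apply: mpoly.meval_eq => i; rewrite tnth_mktuple.
Qed.

(** Otherwise Cauchy's bound would apply to the polynomials with roots z_j^m,
    with a bound that does not depend on m, whereas |z_i|^m is unbounded. *)
Lemma exists_large_mesym_powers z i : 1 < `|z ord0 i| ->
  exists k m, ~~ (`|peval (mesym_powers k m) z| <= (2 ^ n)%:R).
Proof.
move=> z1; apply: contrapT => /forallNP small.
have [m] := @exists_expr_gt R (modulus (z ord0 i)) (n%:R * (2 ^ n)%:R)
  ltac:(by rewrite -ltcR -normC_modulus).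
rewrite -ltcR rmorphXn /= -normC_modulus -normrX rmorphM !rmorph_nat.
apply/negP; rewrite -real_leNgt ?realM ?normr_real ?realn //.
apply: (@monic_root_norm_le _ n (roots_poly (powers m z))).
- exact: monic_prod_XsubC.
- by rewrite size_prod_XsubC size_tuple.
- rewrite root_prod_XsubC; apply/tnthP; exists i.
  by rewrite tnth_mktuple mxE.
- move=> j jn; rewrite -(subKn (ltnW jn)) roots_poly_coef_norm ?leq_subr //.
  rewrite -mesym_powersE; apply: contrapT => /negP large.
  by apply: (small (n - j)%N); exists m.
- by rewrite normrX exprn_ege1 // ltW.
Qed.

(** By Vieta, z can be any enumeration of the roots of
    X^n - x_1 X^(n-1) + x_2 X^(n-2) - .. *)
Lemma symmetrization_surjective (x : Cn) : exists z, symmetrization z = x.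
Proof.
pose q : {poly C} := \sum_(j < n) ((-1) ^+ j.+1 * x ord0 j) *: 'X^(n - j.+1).
have sq : (size q <= n)%N.
  apply: (leq_trans (size_sum _ _ _)); apply/bigmax_leqP => j _.
  apply: (leq_trans (size_scale_leq _ _)).
  by rewrite size_polyXn -subSn // subSS leq_subr.
have sp : size ('X^n + q) = n.+1 by rewrite size_polyDl size_polyXn.
have [r] := closed_field_poly_normal ('X^n + q).
rewrite lead_coefDl ?size_polyXn // lead_coefXn scale1r => pr.
have sr : size r == n by move: sp; rewrite pr size_prod_XsubC => -[->].
exists (\row_i tnth (Tuple sr) i); apply/rowP => k; rewrite mxE.
have := mpoly.mroots_coeff (Tuple sr) (Ordinal (ltn_ord k : (k.+1 < n.+1)%N)).
rewrite /= -pr coefD coefXn.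
have -> : (n - k.+1 == n)%N = false.
  by rewrite ltn_eqF // ltn_subrL (leq_ltn_trans _ (ltn_ord k)).
rewrite add0r coef_sum (bigD1 k) //= coefZ coefXn eqxx mulr1.
rewrite big1 ?addr0; last first.
  move=> j jk; rewrite coefZ coefXn; case: eqP => [e|_]; last by rewrite mulr0.
  have /eqP := congr1 (subn n) e.
  by rewrite !subKn // eqSS eq_sym val_eqE (negbTE jk).
move=> /(mulfI _) ->; last by rewrite signr_eq0.
by apply: mpoly.meval_eq => i; rewrite mxE.
Qed.

(** * Compactness of the closed symmetrized polydisc *)

Definition closed_polydisc : set Cn :=
  [set z | forall i, modulus (z ord0 i) <= 1].

Lemma continuous_sumC (T : topologicalType) (I : Type) (r : seq I)
    (F : I -> T -> C) :
  (forall i, continuous (F i)) -> continuous (fun x => \sum_(i <- r) F i x).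
Proof.
move=> Fc; apply: (@continuous_big C I +%R 0 xpredT _ T r F) => [|i _].
  exact: add_continuous.
exact: Fc.
Qed.

Lemma continuous_prodC (T : topologicalType) (I : Type) (r : seq I)
    (F : I -> T -> C) :
  (forall i, continuous (F i)) -> continuous (fun x => \prod_(i <- r) F i x).
Proof.
move=> Fc; apply: (@continuous_big C I *%R 1 xpredT _ T r F) => [|i _].
  exact: mul_continuous.
exact: Fc.
Qed.

Lemma peval_continuous p : continuous (peval p : Cn -> C).
Proof.
(* Powers are written as products, so that p is a sum of products of coordinates
   and constants. *)
have -> : peval p = fun z : Cn => \sum_(m <- mpoly.msupp p)
    mpoly.mcoeff m p * \prod_i \prod_(j < m i) z ord0 i :> C.
  apply/funext => z; rewrite /peval mpoly.mevalE; apply: eq_bigr => m _.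
  by congr (_ * _); apply: eq_bigr => i _; rewrite prodr_const card_ord.
apply: continuous_sumC => m z; apply: continuousM; first exact: cst_continuous.
apply: continuous_prodC => i; apply: continuous_prodC => _.
exact: coord_continuous.
Qed.

Lemma algebraic_set_closed (V : set Cn) : algebraic_set V -> closed V.
Proof.
move=> [S ->].
have -> : [set z : Cn | forall p, S p -> peval p z = 0] =
    \bigcap_(p in S) (peval p @^-1` [set 0]).
  by [].
apply: closed_bigI => p _; apply: preimage_closed => [z _|].
  exact: peval_continuous.
apply: accessible_closed_set1; apply: hausdorff_accessible.
exact: norm_hausdorff.
Qed.

Lemma cvg_row (T : Type) (F : set_system T) (f : T -> Cn) (l : Cn) :
  Filter F -> (forall i, f t ord0 i @[t --> F] --> l ord0 i) -> f @ F --> l.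
Proof.
move=> FF fl A [Q lQ QA]; apply: (filterS (fun t => QA (f t))).
apply: filter_forall => i; apply: filter_forall => j.
by rewrite ord1; apply: fl; have := lQ i j; rewrite ord1.
Qed.

Lemma symmetrization_continuous : continuous (@symmetrization R n).
Proof.
move=> z; apply: (@cvg_row _ (nbhs z)) => i; rewrite mxE.
under eq_cvg do rewrite mxE.
exact: peval_continuous.
Qed.

Lemma real_complex_continuous : continuous (fun r : R => r%:C%C : C).
Proof.
move=> r; apply/cvgrPdist_lt => e e0.
have eE : (complex.Re e)%:C%C = e by rewrite RRe_real // gtr0_real.
have e'0 : 0 < complex.Re e by rewrite -ltcR eE.
apply: filterS (nbhsx_ballx r _ e'0) => s /= rs.
by rewrite -rmorphB normC_modulus modulus_real -eE ltcR.
Qed.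

Lemma modulus_continuous : continuous (@modulus R).
Proof.
move=> c; apply/(@cvgrPdist_lt _ _ _ (nbhs c)) => e e0.
have e0C : 0 < e%:C%C :> C by rewrite ltcR.
apply: filterS (nbhsx_ballx c _ e0C) => d /= cd.
have distE : `|modulus c - modulus d|%:C%C = `| `|c| - `|d| | :> C.
  by rewrite [RHS]normC_modulus !normC_modulus -rmorphB modulus_real.
rewrite -ltcR distE.
exact: le_lt_trans (ler_dist_dist _ _) cd.
Qed.

(** The disc is closed, and contained in the compact square [-1, 1]^2. *)
Lemma closed_disc_compact : compact [set c : C | modulus c <= 1].
Proof.
pose f (ab : R * R) : C := ab.1%:C%C + 'i%C * ab.2%:C%C.
apply: (@subclosed_compact _ _ (f @` (`[-1, 1] `*` `[-1, 1]))).
- apply: (@preimage_closed _ _ (@modulus R) [set x | x <= 1]) => [c _|].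
    exact: modulus_continuous.
  exact: closed_le.
- apply: continuous_compact.
    2: by apply: compact_setX; exact: segment_compact.
  apply: continuous_subspaceT => ab; apply: cvgD; last apply: cvgM.
  + apply: (@continuous_comp _ _ _ fst (fun r : R => r%:C%C : C) ab).
      exact: cvg_fst.
    exact: real_complex_continuous.
  + exact: cvg_cst.
  + apply: (@continuous_comp _ _ _ snd (fun r : R => r%:C%C : C) ab).
      exact: cvg_snd.
    exact: real_complex_continuous.
- case=> a b /= c1; exists (a, b); last by rewrite [RHS]complexE.
  split; rewrite /= in_itv /= -ler_norml; apply: le_trans c1;
    by rewrite -sqrtr_sqr ler_wsqrtr // ?lerDl ?lerDr sqr_ge0.
Qed.

Lemma closed_polydisc_compact : compact closed_polydisc.
Proof.
apply: (@rV_compact C n (fun=> [set c | modulus c <= 1])) => _.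
exact: closed_disc_compact.
Qed.

Lemma symmetrized_closed_polydisc_compact :
  compact (@symmetrization R n @` closed_polydisc).
Proof.
apply: continuous_compact; last exact: closed_polydisc_compact.
exact/continuous_subspaceT/symmetrization_continuous.
Qed.

Lemma GammaE : @Gamma R n = @symmetrization R n @` closed_polydisc.
Proof.
apply/seteqP; split.
  have /closure_id -> : closed (@symmetrization R n @` closed_polydisc).
    apply: compact_closed; last exact: symmetrized_closed_polydisc_compact.
    exact: norm_hausdorff.
  by apply: closure_subset => _ [z z1 <-]; exists z => // i; exact/ltW/z1.
move=> _ [z z1 <-].
(* pi z is the limit of the points pi (t z) of G as t tends to 1 from below. *)
apply: (@closed_cvg _ _ (1 : R)^'- _ (fun t => symmetrization (t%:C%C *: z))
  (@Gamma R n)).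
- exact: closed_closure.
- near=> t; apply: subset_closure; exists (t%:C%C *: z) => // i.
  have t0 : 0 < t by near: t; apply: nbhs_left_gt.
  have t1 : t < 1 by near: t; apply: nbhs_left_lt.
  rewrite mxE /modulus Normc.normcM -/(modulus _) modulus_real gtr0_norm //.
  by rewrite (le_lt_trans _ t1) // ler_piMr ?(ltW t0) //; exact: z1.
- apply: continuous_cvg; first exact: symmetrization_continuous.
  apply: (@cvg_row _ (1 : R)^'-) => i.
  under eq_cvg do rewrite mxE.
  have : t%:C%C * z ord0 i @[t --> (1 : R)^'-] --> 1%:C%C * z ord0 i.
    apply: cvgM; last exact: cvg_cst.
    exact/cvg_at_left_filter/(@real_complex_continuous (1 : R)).
  by rewrite mul1r.
Unshelve. all: by end_near. Qed.

Lemma Gamma_compact : compact (@Gamma R n).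
Proof. by rewrite GammaE; exact: symmetrized_closed_polydisc_compact. Qed.

(** * Separation by polynomials *)

Lemma Gamma_separation x : ~ @Gamma R n x -> exists (f : polynomial) (B : R),
  [/\ 0 <= B, (forall y, @Gamma R n y -> modulus (peval f y) <= B)
    & B < modulus (peval f x)].
Proof.
have [z <-] := symmetrization_surjective x; rewrite GammaE => nGz.
have [i zi] : exists i, 1 < modulus (z ord0 i).
  apply: contrapT => /forallNP zle; apply: nGz; exists z => // i.
  by rewrite leNgt; apply/negP/zle.
have [|k [m large]] := @exists_large_mesym_powers z i.
  by rewrite normC_modulus ltcR.
have [f fE] := peval_symmetrization (mesym_powers_sym k m).
exists f, (2 ^ n)%:R; split => [//|_ [w w1 <-]|].
  rewrite fE mesym_powersE -lecR -normC_modulus rmorph_nat.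
  apply: mesym_peval_le => j; rewrite mxE normrX exprn_ile1 //.
  by rewrite normC_modulus lecR w1.
move: large; rewrite fE normC_modulus.
by rewrite -(rmorph_nat (real_complex R)) lecR -ltNge.
Qed.

(** The condition 0 <= B is for empty X, as the supremum of set0 is 0. *)
Lemma sup_modulus_lt (X : set Cn) (f : polynomial) (B b : R) :
  (forall y, X y -> modulus (peval f y) <= B) -> 0 <= B -> B < b ->
  sup [set modulus (peval f y) | y in X] < b.
Proof.
move=> fB B0 Bb; apply: le_lt_trans Bb.
have [->|/set0P X0] := eqVneq X set0; first by rewrite image_set0 sup0.
apply: ge_sup; first by case: X0 => y Xy; exists (modulus (peval f y)), y.
by move=> _ [y Xy <-]; exact: fB.
Qed.

End SymmetrizedPolydisc.

Theorem proposition3p17 (R : realType) (n : nat) (hn : (2 <= n)%N)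
    (V Lambda : set 'rV[R[i]]_n) (hLambda : distinguished_variety V Lambda) :
  polynomially_convex (dclosure V).
Proof.
have [[Valg _ _ _] _] := hLambda; split.
  rewrite /dclosure setIC; apply: compact_closedI; first exact: Gamma_compact.
  exact: algebraic_set_closed.
move=> x nx; have [Vx|nVx] := pselect (V x).
  have [|f [B [B0 fB Bx]]] := @Gamma_separation R n x.
    by move=> Gx; apply: nx.
  exists f; apply: (sup_modulus_lt _ B0 Bx) => y [_ Gy]; exact: fB.
case: Valg => S VE; have [p Sp px] : exists2 p, S p & peval p x != 0.
  apply: contrapT => noP; apply: nVx; rewrite VE => p Sp.
  by apply: contrapT => /eqP px; apply: noP; exists p.
have px0 : 0 < modulus (peval p x) by rewrite -ltcR -normC_modulus normr_gt0.
exists p; apply: (sup_modulus_lt _ (lexx 0) px0) => y [+ _].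
by rewrite VE => /(_ p Sp) ->; rewrite /modulus Normc.normc0.
Qed.
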